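(* For each integer $k\ge 4$ let $$\gamma_k:=\inf\Big\{\limsup_{n\to\infty}\frac{\mathrm{ex}_c(n,T)}{\frac{n(k-2)}{2}} \;:\; T \text{ is a tree on } k \text{ vertices}\Big\},\qquad \gamma:=\lim_{k\to\infty}\gamma_k .$$ Then $\gamma=\frac12$; that is, the limit $\lim_{k\to\infty}\gamma_k$ exists and equals $\frac12$.
   Context: All graphs are finite and simple. For a graph $F$, the connected extremal number $\mathrm{ex}_c(n,F)$ is the maximum number of edges in an $n$-vertex connected graph that contains no (not necessarily induced) subgraph isomorphic to $F$. *)

(* Defs.v *)
From HB Require Import structures.
From mathcomp Require Import all_boot all_order all_algebra.
From mathcomp Require Import all_classical all_reals all_analysis.

Set Implicit Arguments.
Unset Strict Implicit.
Unset Printing Implicit Defensive.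

Import Order.TTheory GRing.Theory Num.Theory.
Import numFieldNormedType.Exports.

Local Open Scope classical_set_scope.
Local Open Scope ring_scope.

(* A graph on the vertex set V is given by its edge set, a family of
   two-element subsets of V; all graphs on a given V thus form a finite type
   over which a maximum can be taken. *)
Definition simple_graph (V : finType) (E : {set {set V}}) : bool :=
  [forall e in E, #|e| == 2%N].

(* [set x; x] is a singleton, so adj E is irreflexive when E is simple. *)
Definition adj (V : finType) (E : {set {set V}}) : rel V :=
  fun x y => [set x; y]%SET \in E.

Definition connected_graph (V : finType) (E : {set {set V}}) : bool :=
  (0 < #|V|)%N && [forall x, forall y, connect (adj E) x y].

(* Closed walks x, y, x satisfy ucycle with size 2; genuine cycles have at
   least three vertices. *)
Definition acyclic_graph (V : finType) (E : {set {set V}}) : Prop :=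
  forall c : seq V, ucycle (adj E) c -> (size c < 3)%N.

Definition is_tree (V : finType) (E : {set {set V}}) : Prop :=
  [/\ simple_graph E, connected_graph E & acyclic_graph E].

Definition contains_copy (U V : finType) (F : {set {set U}})
    (E : {set {set V}}) : bool :=
  [exists f : {ffun U -> V},
     injectiveb f && [forall x, forall y, adj F x y ==> adj E (f x) (f y)]].

(* The maximum of an empty family is 0 here. When F is a tree on k >= 4
   vertices and n >= 1 the family is nonempty: F is not both a star and a path,
   so the n-vertex star or the n-vertex path is F-free. *)
Definition ex_c (n : nat) (U : finType) (F : {set {set U}}) : nat :=
  \max_(E : {set {set 'I_n}} |
          [&& simple_graph E, connected_graph E & ~~ contains_copy F E]) #|E|.

(* The limit superior and the infimum are taken in the extended reals, where
   they always exist. *)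
Definition tree_density (R : realType) (k : nat) (T : {set {set 'I_k}}) :
    \bar R :=
  limn_esup (fun n : nat =>
    ((ex_c n T)%:R / (n%:R * (k%:R - 2) / 2))%:E).

Definition gamma (R : realType) (k : nat) : \bar R :=
  ereal_inf [set tree_density R T | T in [set T : {set {set 'I_k}} | is_tree T]].

(* Main.v *)
Require Import Defs.
From mathcomp Require Import all_boot zify.
From mathcomp Require boolp.

Set Implicit Arguments.
Unset Strict Implicit.
Unset Printing Implicit Defensive.

(** Upper and lower bounds for [gamma R k] differ from one half by O(1/k).

    Upper bound.  Take for the tree a broom: a path with [l] edges, [l = k/2],
    whose starting vertex carries [k - l - 1] further leaves.  A connected
    graph on [n] vertices with more than [l * n / 2] edges contains a cycle of
    length greater than [l] (Erdos and Gallai, [erdos_gallai]), and running to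
    this cycle and around it gives a path with [l] edges from any prescribed
    vertex.  If some vertex has degree at least [k - 1], such a path from it
    leaves enough neighbours for the leaves of a broom.  If there is none,
    balls of radius [l] have bounded size, so for large [n] every vertex starts a geodesic
    with [l] edges; a geodesic meets the neighbourhood of its origin only once,
    and the average degree provides an origin of degree greater than
    [k - l - 1].  Hence [4 * ex_c n (broom l k) <= k * n] for large [n]
    ([broom_free_edges]).

    Lower bound.  Let [T] be connected on [k] vertices and [a = k / 4].  If no
    proper 2-colouring of [T] has a class with at most [a] vertices, then the
    complete bipartite graph with parts [a] and [n - a] is T-free and has about
    [n * k / 4] edges.  Otherwise consider cliques on [m] vertices strung on a
    line, consecutive ones joined by a path with [L] inner vertices.  In a copy
    of [T], an end piece all of whose vertices have degree at most 2 is a tail,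
    that is, a pendant path of [T], and a connecting path with vertices of
    degree at least 3 on both sides is an inner path of [T], whose vertices have
    degree 2.  So [T] does not embed if [m] is less than [k] minus the size [P]
    of any two disjoint tails and [L] is greater than the size [l] of any inner
    path ([chain_free]).  Tails and inner paths are disjoint and every other
    vertex on them lies in the small colour class, so that
    [P + l <= 2 * a + 3] ([tails_core_length]).  The average
    degree is then

      [m * (m - 1) / (m + L)],  where  [2 * (m - 1) >= (m + L) + k / 2 - O(1)],

    and the inequality between the arithmetic and the geometric mean gives
    [(m - 1) ^ 2 >= (m + L) * (k / 2 - O(1))], which is the bound
    ([tree_free_dense_graph]). *)

(** * Long cycles in dense graphs *)

Lemma ex_max_measure (X : Type) (P : X -> Prop) (mu : X -> nat) (b : nat) :
  (exists x, P x) -> (forall x, P x -> mu x <= b) ->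
  exists2 x, P x & forall y, P y -> mu y <= mu x.
Proof.
move=> [x0 Px0] bnd.
have [n] := ubnP (b - mu x0); elim: n => // n IHn in x0 Px0 * => lt_n.
have [[y [Py ltxy]]|maxx] := boolp.EM (exists y, P y /\ mu x0 < mu y).
  by apply: (IHn y) => //; have := bnd y Py; lia.
exists x0 => // y Py; rewrite leqNgt; apply/negP => ltxy.
by case: maxx; exists y.
Qed.

Section Degrees.
Variables (V : finType) (e : rel V).

Definition nbrs x : {set V} := [set y | e x y].

Hypothesis e_sym : symmetric e.

Lemma sum_nbrsC (A B : {set V}) :
  \sum_(x in A) #|nbrs x :&: B| = \sum_(x in B) #|nbrs x :&: A|.
Proof.
have card_sum (D : {set V}) x : #|nbrs x :&: D| = \sum_(y in D) e x y.
  rewrite -sum1_card [RHS]big_mkcond /= big_mkcond /=; apply: eq_bigr => y _.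
  by rewrite !inE; case: (y \in D); case: (e x y).
under eq_bigr do rewrite card_sum; rewrite exchange_big /=.
by apply: eq_bigr => y _; rewrite card_sum; apply: eq_bigr => x _; rewrite e_sym.
Qed.

Lemma sum_nbrs_delete (S S' : {set V}) : S' \subset S ->
  \sum_(x in S) #|nbrs x :&: S| =
  \sum_(x in S :\: S') #|nbrs x :&: (S :\: S')| +
  \sum_(x in S') (#|nbrs x :&: S| + #|nbrs x :&: (S :\: S')|).
Proof.
move=> sS'S; rewrite big_split /= (sum_nbrsC S' (S :\: S')) (big_setID S') /=.
rewrite (setIidPr sS'S) addnCA; congr (_ + _); rewrite -big_split /=.
apply: eq_bigr => x _; rewrite -(cardsID S' (nbrs x :&: S)) addnC; congr (_ + _).
  by rewrite setIDA.
by rewrite -setIA (setIidPr sS'S).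
Qed.

Hypothesis e_irr : irreflexive e.

(** The set that can be deleted in the induction for [erdos_gallai].  Among the
    longest paths choose one whose endpoint has its farthest neighbour as far
    along the path as possible.  The part [C] of the path up to that neighbour
    closes to a cycle, so it has at most [l] vertices.  Posa rotations inside
    [C] yield further longest paths, and the maximality of the choice keeps all
    neighbours of their endpoints inside [C].  Among these rotated paths take
    one whose endpoint has the largest degree [t].  The predecessors [S'] of its
    [t] neighbours are again endpoints: they have degree at most [t], all of it
    in [C].  As [C] has at most [l - t] vertices outside [S'], each of them
    contributes at most [t + (l - t)] to the sum.  Paths are lists in [S] whose
    endpoint is the head. *)
Lemma rotation_set (S : {set V}) (l : nat) :
  S != set0 -> (forall x, x \in S -> nbrs x :&: S != set0) ->
  (forall c, ucycle e c -> size c <= l) ->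
  exists S' : {set V}, [/\ S' \subset S, S' != set0 &
    \sum_(x in S') (#|nbrs x :&: S| + #|nbrs x :&: (S :\: S')|) <= l * #|S'|].
Proof.
move=> /set0Pn[x0 x0S] degS cyc.
pose hp p := [&& 0 < size p, uniq p, all (mem S) p & sorted e p].
have [p0 hp0 maxp0] : exists2 p, hp p & forall q, hp q -> size q <= size p.
  apply: (@ex_max_measure _ hp size #|V|).
    by exists [:: x0]; rewrite /hp /= x0S.
  by move=> p /and4P[_ /card_uniqP <- _ _]; apply: max_card.
set r := size p0 in maxp0.
have nbr_in q x : hp q -> size q = r -> x \in nbrs (head x0 q) :&: S -> x \in q.
  move=> hq sq; rewrite !inE => /andP[exh xS]; apply/negPn/negP => xq.
  have: hp (x :: q).
    case: q hq {sq} exh xq => // y q /and4P[_ /= uq /andP[yS aq] pq] exy xq.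
    by rewrite /hp /= xS yS aq [e x y]e_sym exy pq xq uq.
  by move/maxp0 => /=; rewrite sq ltnn.
(* Longest paths paired with a position occupied by a neighbour of the head. *)
pose far (pc : seq V * nat) := [/\ hp pc.1, size pc.1 = r, pc.2 < r &
  e (head x0 pc.1) (nth x0 pc.1 pc.2)].
have [[p c] /= [hpp sp cr epc] maxc] :
  exists2 pc, far pc & forall pc', far pc' -> pc'.2 <= pc.2.
  apply: (@ex_max_measure _ far snd r) => [|pc [_ _ /ltnW //]].
  have hS : head x0 p0 \in S.
    by case: p0 hp0 {maxp0 r nbr_in far} => // y q /and4P[_ _ /= /andP[]].
  have /set0Pn[y yN] := degS _ hS.
  have yp := nbr_in _ _ hp0 erefl yN.
  exists (p0, index y p0); split => //=; first by rewrite index_mem.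
  by rewrite nth_index //; move: yN; rewrite !inE => /andP[].
rewrite /= in hpp sp cr epc.
(* The paths that only rearrange the first [c] vertices of [p]; the rotations
   below do not leave this family. *)
pose F q := [/\ hp q, drop c q = drop c p & perm_eq (take c q) (take c p)].
have Fsize q : F q -> size q = r.
  case=> _ Ed /perm_size Et.
  by rewrite -(cat_take_drop c q) size_cat Ed Et -size_cat cat_take_drop.
have [q Fq maxdeg] : exists2 q, F q & forall q', F q' ->
    #|nbrs (head x0 q') :&: S| <= #|nbrs (head x0 q) :&: S|.
  apply: (@ex_max_measure _ F _ #|V|) => [|q _]; last exact: max_card.
  by exists p; split.
pose C := [set x in take c.+1 p].
have FC q' : F q' -> take c.+1 q' =i C.
  move=> Fq' x; case: (Fq') => _ Ed Et; rewrite inE.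
  by rewrite -addn1 !takeD Ed !mem_cat (perm_mem Et).
have nbr_idx q' y : F q' -> y \in nbrs (head x0 q') :&: S ->
    [/\ y \in q', 0 < index y q' & index y q' <= c].
  move=> Fq' yN; have [hq' _ _] := Fq'; have sq' := Fsize _ Fq'.
  have yq' := nbr_in _ _ hq' sq' yN; move: yN; rewrite !inE => /andP[ey yS].
  split=> //.
    case: q' {Fq' hq' sq'} yq' ey => // z q' _ /=.
    by case: eqP => [->|//]; rewrite e_irr.
  by apply: (maxc (q', _)); split; rewrite //= ?nth_index // -sq' index_mem.
have nbrC q' : F q' -> nbrs (head x0 q') :&: S \subset C.
  move=> Fq'; apply/subsetP => y /(nbr_idx _ _ Fq')[yq _ ic].
  by rewrite -(FC _ Fq') in_take.
have cardC : #|C| <= l.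
  have szC : size (take c.+1 p) = c.+1 by rewrite size_takel // sp.
  have /and4P[p_gt0 up _ pp] := hpp.
  have uC : uniq (take c.+1 p) by rewrite take_uniq.
  have -> : #|C| = size (take c.+1 p).
    by rewrite -(card_uniqP uC); apply: eq_card => x; rewrite inE.
  apply: cyc; rewrite /ucycle uC andbT.
  have p_gt : 0 < size p by rewrite sp; lia.
  case: p p_gt {hpp maxc F Fsize q Fq maxdeg C FC nbr_idx nbrC uC p_gt0}
    sp up epc szC pp => //= x s _ sp _ exc _ pp.
  rewrite rcons_path take_path //= e_sym.
  suff -> : last x (take c s) = nth x0 (x :: s) c by [].
  case: c cr exc => [|c] cr _; first by rewrite take0.
  by rewrite (last_nth x0) size_takel ?[LHS]nth_take //=; lia.
(* One rotation: reverse the initial segment that ends just before [y]. *)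
have rot_F y : y \in nbrs (head x0 q) :&: S ->
    exists2 q', F q' & head x0 q' = nth x0 q (index y q).-1.
  move=> yN; have [yq i_gt0 ic] := nbr_idx _ _ Fq yN.
  have [hq Ed Et] := Fq; have sq := Fsize _ Fq.
  set j := index y q in i_gt0 ic *.
  have jq : j < size q by rewrite index_mem.
  have szj : size (take j q) = j by rewrite size_takel 1?ltnW.
  have perm_rot : perm_eq (rev (take j q) ++ drop j q) q.
    by rewrite -{3}(cat_take_drop j q) perm_cat2r perm_rev.
  have head_rot : head x0 (rev (take j q) ++ drop j q) = nth x0 q j.-1.
    rewrite -nth0 nth_cat size_rev szj i_gt0 nth_rev ?szj // subn1.
    by rewrite nth_take // ltn_predL.
  exists (rev (take j q) ++ drop j q) => //; split.
  - have [q_gt0 uq aq pq] := and4P hq; apply/and4P; split.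
    + by rewrite (perm_size perm_rot).
    + by rewrite (perm_uniq perm_rot).
    + by rewrite (perm_all _ perm_rot).
    have e_yh : e (head x0 q) y by move: yN; rewrite !inE => /andP[].
    rewrite (drop_nth x0 jq) nth_index //.
    have: sorted e (rev (take j q)).
      by rewrite rev_sorted (eq_sorted (e' := e)) ?take_sorted // => u v; rewrite e_sym.
    have: path e y (drop j.+1 q).
      by have := drop_sorted j pq; rewrite (drop_nth x0 jq) nth_index.
    have -> : take j q = head x0 q :: take j.-1 (behead q).
      by case: (q) q_gt0 => // h q' _ /=; rewrite -[in LHS](prednK i_gt0).
    rewrite rev_cons => py; case: (rev _) => [|z s] /=; first by rewrite e_yh.
    by rewrite cat_path => ->; rewrite last_rcons /= e_yh.
  - rewrite -Ed drop_cat size_rev szj ltnNge ic /=.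
    by rewrite drop_drop subnK.
  - rewrite take_cat size_rev szj ltnNge ic /=.
    rewrite (perm_trans _ Et) // -{2}(subnKC ic) takeD perm_cat2r perm_rev //.
pose S' := [set nth x0 q (index y q).-1 | y in nbrs (head x0 q) :&: S].
have headS q' : F q' -> head x0 q' \in S.
  by case=> /and4P[]; case: q' => //= h q' _ _ /andP[].
have headC q' : F q' -> 0 < c -> head x0 q' \in C.
  move=> Fq' c_gt0; rewrite -(FC _ Fq'); have := Fsize _ Fq'.
  by case: q' {Fq'} => /= [|h q' _]; [lia | rewrite mem_head].
have S'P s : s \in S' -> exists2 q', F q' & s = head x0 q'.
  by move=> /imsetP[y /rot_F[q' Fq' <-] ->]; exists q'.
have [y0 y0N] : exists y, y \in nbrs (head x0 q) :&: S.
  by apply/set0Pn/degS/headS.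
have c_gt0 : 0 < c by have [_ i_gt0 /(leq_trans i_gt0)] := nbr_idx _ _ Fq y0N.
have cardS' : #|S'| = #|nbrs (head x0 q) :&: S|.
  apply: card_in_imset => y z /(nbr_idx _ _ Fq)[yq iy _] /(nbr_idx _ _ Fq)[zq iz _].
  have [/and4P[_ uq _ _] _ _] := Fq.
  move: (yq) (zq); rewrite -!index_mem => yq' zq' /eqP.
  rewrite nth_uniq //; try lia; move=> /eqP E.
  by rewrite -(nth_index x0 yq) -(nth_index x0 zq); congr nth; lia.
have S'C : S' \subset C by apply/subsetP => s /S'P[q' /headC hC ->]; apply: hC.
exists S'; split.
- by apply/subsetP => s /S'P[q' /headS hS ->].
- by apply/set0Pn; eexists; apply: imset_f y0N.
- apply: (@leq_trans (\sum_(x in S') #|C|)); last first.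
    by rewrite sum_nat_const mulnC leq_mul2r cardC orbT.
  apply: leq_sum => s /S'P[q' Fq' ->].
  rewrite -(cardsID S' C) (setIidPr S'C) cardS' leq_add ?maxdeg //.
  by rewrite setIDA subset_leq_card // setSD // nbrC.
Qed.

(** Forbidding long cycles, unlike forbidding long paths from a given vertex, is
    inherited by the subgraphs that arise from deleting [rotation_set]; no
    connectedness has to be maintained. *)
Lemma erdos_gallai (S : {set V}) (l : nat) :
  (forall c, ucycle e c -> size c <= l) ->
  \sum_(x in S) #|nbrs x :&: S| <= l * #|S|.
Proof.
move=> cyc; have [n] := ubnP #|S|; elim: n => // n IHn in S * => ltSn.
have delete (S' : {set V}) : S' \subset S -> S' != set0 ->
    \sum_(x in S') (#|nbrs x :&: S| + #|nbrs x :&: (S :\: S')|) <= l * #|S'| ->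
    \sum_(x in S) #|nbrs x :&: S| <= l * #|S|.
  move=> sS'S; rewrite -card_gt0 => S'_gt0 le_S'; rewrite (sum_nbrs_delete sS'S).
  have cardS := cardsID S' S; rewrite (setIidPr sS'S) in cardS.
  by rewrite -cardS mulnDr addnC leq_add // IHn //; lia.
have [->|S_n0] := eqVneq S set0; first by rewrite big_set0.
have [degS|] := boolP [forall x in S, nbrs x :&: S != set0].
  have [|S' [sS'S S'_n0 le_S']] := rotation_set S_n0 _ cyc; last exact: (delete S').
  exact/forall_inP.
rewrite negb_forall_in => /exists_inP[x xS]; rewrite negbK => /eqP Nx.
apply: (delete [set x]); rewrite ?sub1set // -?card_gt0 ?cards1 // big_set1 Nx.
by rewrite setIDA Nx set0D cards0.
Qed.
End Degrees.

(** * Graphs as edge sets *)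

Section GraphOf.
Variables (V : finType).

Lemma adj_sym (E : {set {set V}}) : symmetric (adj E).
Proof. by move=> x y; rewrite /adj setUC. Qed.

Lemma adj_irr (E : {set {set V}}) : simple_graph E -> irreflexive (adj E).
Proof.
move=> /forall_inP sE x; apply/negP => /sE.
by rewrite setUid cards1.
Qed.

Lemma handshake (E : {set {set V}}) : simple_graph E ->
  \sum_x #|nbrs (adj E) x| = 2 * #|E|.
Proof.
move=> sE; have /forall_inP E2 := sE.
transitivity (\sum_x #|[set f in E | x \in f]|).
  apply: eq_bigr => x _.
  have <- : (fun y => [set x; y]) @: nbrs (adj E) x = [set f in E | x \in f].
    apply/setP => f; apply/imsetP/idP => [[y]|].
      by rewrite inE => xy ->; rewrite !inE eqxx andbT.
    rewrite inE => /andP[fE xf]; have /cards2P[a [b [ab Ef]]] := E2 f fE.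
    move: xf fE; rewrite {}Ef !inE => /orP[]/eqP-> abE; first by exists b; rewrite ?inE.
    by exists a; rewrite 1?inE /adj setUC.
  rewrite card_in_imset // => y z; rewrite !inE => xy xz /setP/(_ y).
  rewrite !inE eqxx orbT => /esym/orP[]/eqP // yx.
  by move: xy; rewrite yx adj_irr.
under eq_bigr => x _ do (rewrite -sum1_card big_mkcond /=;
  under eq_bigr => f _ do rewrite inE).
rewrite exchange_big /= -sum1_card big_distrr /= [RHS]big_mkcond /=.
apply: eq_bigr => f _; case fE: (f \in E) => /=; last by rewrite big1.
by rewrite -big_mkcond /= sum1_card (eqP (E2 f fE)).
Qed.

Variables (g : rel V).
Definition graph_of : {set {set V}} :=
  [set [set p.1; p.2] | p : V * V in [set p | g p.1 p.2]].

Hypotheses (g_sym : symmetric g) (g_irr : irreflexive g).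

Lemma adj_graph_of : adj graph_of =2 g.
Proof.
move=> x y; apply/imsetP/idP => [[[a b]]|gxy]; last by exists (x, y); rewrite ?inE.
rewrite inE /= => gab exy.
have ab : a != b by apply: contraTneq gab => ->; rewrite g_irr.
have xy : x != y.
  by have := congr1 (fun B : {set V} => #|B|) exy; rewrite !cards2 ab; case: (x != y).
have /set2P[Ex|Ex] : x \in [set a; b] by rewrite -exy set21.
  have /set2P[Ey|->] : y \in [set a; b]; rewrite -?exy ?set22 //; last by rewrite Ex.
  by rewrite Ex Ey eqxx in xy.
have /set2P[->|Ey] : y \in [set a; b]; rewrite -?exy ?set22 //; first by rewrite Ex g_sym.
by rewrite Ex Ey eqxx in xy.
Qed.

Lemma graph_of_simple : simple_graph graph_of.
Proof.
apply/forall_inP => f /imsetP[[a b]]; rewrite inE /= => gab ->.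
by rewrite cards2; have [ab|] := eqVneq a b; rewrite // ab g_irr in gab.
Qed.
End GraphOf.

(** * Paths with a prescribed origin *)

Section LongPaths.
Variables (V : finType) (e : rel V).
Hypotheses (e_sym : symmetric e) (e_irr : irreflexive e).
Hypothesis e_conn : forall x y, connect e x y.

(** Density gives a cycle with more than [l] vertices; connectedness leads from
    [v] to the cycle, and the path continues around it. *)
Lemma dense_long_path (l : nat) v : l * #|V| < \sum_x #|nbrs e x| ->
  exists p, [/\ path e v p, uniq (v :: p) & size p = l].
Proof.
move=> dense.
suff [p [pp up szp]] : exists p, [/\ path e v p, uniq (v :: p) & l <= size p].
  exists (take l p); rewrite take_path // size_takel //.
  by split=> //; have := take_uniq l.+1 up.
have [c /andP[cc uc] ltlc] : exists2 c, ucycle e c & l < size c.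
  apply: boolp.contrapT => noc; move: dense.
  rewrite ltnNge -cardsT; suff -> : \sum_x #|nbrs e x| <= l * #|[set: V]| by [].
  rewrite (eq_bigl (mem [set: V])) => [|x]; last by rewrite /= inE.
  under eq_bigr do rewrite -[nbrs _ _]setIT.
  apply: erdos_gallai => // c cc; rewrite leqNgt; apply/negP => ltlc.
  by apply: noc; exists c.
have rotc y : y \in c -> exists s,
    [/\ path e y s, uniq (y :: s), y :: s =i c & size c = (size s).+1].
  move=> yc; have [i s Es] := rot_to yc; exists s.
  have : cycle e (rot i c) by rewrite rot_cycle.
  rewrite Es /= rcons_path => /andP[-> _]; split=> //.
  - by have := rot_uniq i c; rewrite Es uc.
  - by move=> z; rewrite -Es mem_rot.
  - by rewrite -(size_rot i c) Es.
have [vc|vc] := boolP (v \in c).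
  by have [s [ps us _ sz]] := rotc v vc; exists s; split=> //; lia.
have [y0 y0c] : exists y, y \in c.
  by case: (c) ltlc => // y ? _; exists y; rewrite mem_head.
have /connectP[p0 pp0 Ey0] := e_conn v y0.
case/shortenP: pp0 Ey0 => p pp up _ Ey0.
have hasp : has (mem c) p.
  apply/hasP; exists y0 => //; case: (p) Ey0 => [/= Ey0|z s ->].
    by move: vc; rewrite -Ey0 y0c.
  exact: (mem_last z s).
case: (split_find hasp) pp up {Ey0} => y p1 p2 yc nop1.
rewrite cat_path rcons_path -cat_cons cat_uniq last_rcons.
move=> /andP[/andP[pp1 ey] _] /and3P[up1 _ _].
have [s [ps us cs sz]] := rotc y yc.
exists (rcons p1 y ++ s); split.
- by rewrite cat_path rcons_path pp1 ey last_rcons.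
- rewrite -cat_cons cat_uniq up1 /=; move: us => /= /andP[ys ->]; rewrite andbT.
  apply/hasPn => z zs /=; have zc : z \in c by rewrite -cs inE zs orbT.
  rewrite inE mem_rcons inE !negb_or; apply/and3P; split.
  + by apply: contraNneq vc => <-.
  + by apply: contraNneq ys => <-.
  + by apply: contra nop1 => zp1; apply/hasP; exists z.
- by rewrite sz ltnS in ltlc; rewrite size_cat (leq_trans ltlc) // leq_addl.
Qed.

(** With degrees below [k] the ball of radius [l] has at most [k ^ l] vertices,
    so a shortest path from [v] to a vertex outside it has more than [l] edges;
    on a shortest path only the first step is adjacent to [v]. *)
Lemma far_path (k l : nat) v : (forall x, #|nbrs e x| < k) -> k ^ l < #|V| ->
  exists p, [/\ path e v p, uniq (v :: p), size p = l &
    {in behead p, forall y, ~~ e v y}].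
Proof.
move=> degk ltkV.
pose step (B : {set V}) := B :|: \bigcup_(x in B) nbrs e x.
pose ball j := iter j step [set v].
have card_ball j : #|ball j| <= k ^ j.
  elim: j => [|j IHj]; first by rewrite cards1.
  apply: (@leq_trans (#|ball j| * k)); last by rewrite expnSr leq_mul2r IHj orbT.
  rewrite /ball iterS -/(ball j) (leq_trans (leq_card_setU _ _)) //.
  have le_cup : #|\bigcup_(x in ball j) nbrs e x| <= \sum_(x in ball j) k.-1.
    elim/big_rec2: _ => [|x n B _ leBn]; first by rewrite cards0.
    by rewrite (leq_trans (leq_card_setU _ _)) // leq_add //; have := degk x; lia.
  have k_gt0 : 0 < k by have := degk v; lia.
  move: le_cup; rewrite sum_nat_const -[in _ * k](prednK k_gt0) mulnS.
  by rewrite leq_add2l.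
have ball_path j p : path e v p -> size p <= j -> last v p \in ball j.
  elim: j p => [|j IHj] p; first by case: p => //= _ _; rewrite inE.
  case/lastP: p => [|p x]; last first.
    rewrite rcons_path size_rcons last_rcons => /andP[pp epx] lepj.
    rewrite !inE; apply/orP; right; apply/bigcupP.
    by exists (last v p); rewrite ?inE ?IHj.
  by move=> _ _; rewrite inE IHj.
have [w wV] : exists w, w \notin ball l.
  apply/existsP; rewrite -negb_forall; apply/negP => /forallP ballT.
  have: #|V| <= k ^ l.
    by rewrite (leq_trans _ (card_ball l)) // -cardsT subset_leq_card //; apply/subsetP.
  by rewrite leqNgt ltkV.
pose P p := [/\ path e v p, uniq (v :: p) & last v p = w].
have size_uniq p : P p -> size p < #|V|.
  by case=> _ /card_uniqP /= Eq _; rewrite -Eq max_card.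
have [p [pp up lp] minp] :
  exists2 p, P p & forall q, P q -> #|V| - size q <= #|V| - size p.
  apply: (@ex_max_measure _ P _ #|V|) => [|q _]; last exact: leq_subr.
  have /connectP[p0 pp0 Ew] := e_conn v w.
  by case/shortenP: pp0 Ew => p pp up _ Ew; exists p.
have ltlp : l < size p.
  by rewrite ltnNge; apply: contraNN wV => lepl; rewrite -lp ball_path.
exists (take l p); split.
- exact: take_path.
- by have := take_uniq l.+1 up.
- by rewrite size_takel // ltnW.
case: p pp up lp minp ltlp => // x s; case: l {ltkV wV} => //= l.
move=> pp up lp minp ltlp y /mem_take ys; apply/negP => evy.
case/splitPr: ys pp up lp minp {ltlp} => s1 s2.
rewrite cat_path last_cat => /and3P[_ _ /= /andP[_ ps2]] up lp minp.
have Ps2 : P (y :: s2).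
  split=> //=; rewrite ?evy //; move: up.
  rewrite !inE !mem_cat !inE !negb_or cat_uniq /=.
  by move=> /and3P[/and4P[_ _ -> ->] _ /and3P[_ _ ->]].
by have := minp _ Ps2; have := size_uniq _ Ps2; rewrite /= size_cat /=; lia.
Qed.
End LongPaths.

(** * Brooms and the upper bound *)

Section Broom.
Variables (l k : nat).
(** The vertices 0, ..., l form the handle and the vertices above [l] are leaves
    attached to 0; every vertex but 0 is joined to its parent, which precedes
    it. *)
Definition broom_parent (i : nat) := if i <= l then i.-1 else 0.
Definition broom_rel : rel 'I_k := fun i j =>
  ((0 < i) && (j == broom_parent i :> nat)) ||
  ((0 < j) && (i == broom_parent j :> nat)).
Definition broom := graph_of broom_rel.

Lemma broom_parent_lt i : 0 < i -> broom_parent i < i.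
Proof. by rewrite /broom_parent; case: ifP => _; lia. Qed.

Lemma broom_rel_sym : symmetric broom_rel.
Proof. by move=> i j; rewrite /broom_rel orbC. Qed.

Lemma broom_rel_irr : irreflexive broom_rel.
Proof.
move=> i; rewrite /broom_rel orbb; apply/negP => /andP[i_gt0 /eqP Ei].
by have := broom_parent_lt i_gt0; rewrite -Ei ltnn.
Qed.

(** In a cycle with at least three vertices both cyclic neighbours of the
    greatest vertex would be its parent. *)
Lemma broom_tree : 0 < k -> is_tree broom.
Proof.
move=> k_gt0; pose o := Ordinal k_gt0.
have adjE := adj_graph_of broom_rel_sym broom_rel_irr; split.
- exact: graph_of_simple broom_rel_irr.
- rewrite /connected_graph card_ord k_gt0 /=.
  have conn_o i : connect (adj broom) i o.
    have [n] := ubnP (i : nat); elim: n => // n IHn in i * => lt_in.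
    have [i0|i_gt0] := posnP i; first by rewrite (_ : i = o) //; apply: val_inj.
    have lt_pi := broom_parent_lt i_gt0.
    apply: (@connect_trans _ _ (Ordinal (ltn_trans lt_pi (ltn_ord i)))).
      by apply: connect1; rewrite adjE /broom_rel i_gt0 /= eqxx.
    by apply: IHn => /=; lia.
  apply/forallP => i; apply/forallP => j; apply: connect_trans (conn_o i) _.
  by rewrite (sym_connect_sym (@adj_sym _ _)).
- move=> c /andP[cc uc]; rewrite ltnNge; apply/negP => c_ge3.
  have [x xc maxx] : exists2 x, x \in c & forall y, y \in c -> y <= x.
    apply: (@ex_max_measure _ (fun x => x \in c) (@nat_of_ord k) k).
      by case: (c) c_ge3 => // x ? _; exists x; rewrite mem_head.
    by move=> x _; rewrite ltnW.
  have [i s Es] := rot_to xc.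
  have : cycle (adj broom) (rot i c) by rewrite rot_cycle.
  have : uniq (rot i c) by rewrite rot_uniq.
  have : size (rot i c) = size c by rewrite size_rot.
  have : {in rot i c, forall y : 'I_k, y <= x} by move=> y; rewrite mem_rot; apply: maxx.
  rewrite Es; case/lastP: s {Es} => [|s z]; first by move=> _ Ec; rewrite -Ec in c_ge3.
  case: s => [|y s]; first by move=> _ Ec; rewrite -Ec in c_ge3.
  move=> le_x _ us; rewrite /= rcons_path last_rcons => /andP[xy /andP[_ zx]].
  have par w : w \in y :: rcons s z -> broom_rel x w -> w = broom_parent x :> nat.
    move=> wc /orP[/andP[_ /eqP//]|/andP[w_gt0 /eqP Ex]].
    have := broom_parent_lt w_gt0; rewrite -Ex ltnNge le_x //.
    by rewrite inE wc orbT.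
  move: us; rewrite /= mem_rcons inE negb_or => /and3P[_ /andP[/eqP yz _] _].
  have xz : broom_rel x z by rewrite -adjE adj_sym.
  rewrite adjE in xy; apply: yz; apply: val_inj.
  apply: etrans (par y _ xy) (esym (par z _ xz)); first exact: mem_head.
  by rewrite inE mem_rcons mem_head orbT.
Qed.

(** The broom's numbering is matched with the path followed by the neighbours of
    [v] off the path. *)
Lemma broom_copy (V : finType) (E : {set {set V}}) v p :
  l < k -> path (adj E) v p -> uniq (v :: p) -> size p = l ->
  k - l.+1 <= #|nbrs (adj E) v :\: [set x in p]| -> ~~ (v \in nbrs (adj E) v) ->
  contains_copy broom E.
Proof.
move=> lt_lk pp up szp deg vv.
set L := nbrs _ _ :\: _ in deg.
pose s := (v :: p) ++ enum L.
have us : uniq s.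
  rewrite cat_uniq up enum_uniq andbT /=; apply/hasPn => x; rewrite mem_enum !inE.
  move=> /andP[xp vx]; rewrite negb_or xp andbT; apply: contraNneq vv => xv.
  by rewrite inE -{2}xv.
have szs : k <= size s by rewrite size_cat -cardE /= szp; lia.
apply/existsP; exists [ffun i : 'I_k => nth v s i]; apply/andP; split.
  apply/injectiveP => i j; rewrite !ffunE => /eqP; rewrite nth_uniq //.
  - by move/eqP/val_inj.
  - by rewrite (leq_trans (ltn_ord i)).
  - by rewrite (leq_trans (ltn_ord j)).
have par (i : 'I_k) : 0 < i -> adj E (nth v s i) (nth v s (broom_parent i)).
  move=> i_gt0; rewrite adj_sym /broom_parent /s.
  have [le_il|lt_li] := leqP i l.
    rewrite !nth_cat /= szp !ltnS le_il (leq_trans (leq_pred _)) //.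
    move/(pathP v): pp => /(_ i.-1); rewrite szp prednK // => /(_ le_il).
    by have -> : nth v (v :: p) i = nth v p i.-1 by case: (nat_of_ord i) i_gt0.
  rewrite [nth _ _ 0]/= nth_cat /= szp ltnS leqNgt lt_li /=.
  have: nth v (enum L) (i - l.+1) \in L.
    by rewrite -mem_enum mem_nth // -cardE; have := ltn_ord i; lia.
  by rewrite !inE => /andP[].
apply/forallP => i; apply/forallP => j; apply/implyP.
rewrite (adj_graph_of broom_rel_sym broom_rel_irr) !ffunE.
case/orP=> /andP[gt0 /eqP ->]; first exact: par.
by rewrite adj_sym par.
Qed.
End Broom.

(** If some vertex has degree at least [k - 1], even a path from it through its
    own neighbourhood leaves [k - 1 - l] neighbours.  Otherwise degrees are
    bounded and the handle can be a geodesic, which costs one neighbour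
    only. *)
Lemma broom_free_edges (l k : nat) (V : finType) (E : {set {set V}}) :
  l < k -> simple_graph E -> connected_graph E -> ~~ contains_copy (broom l k) E ->
  k ^ l < #|V| -> 2 * #|E| <= maxn l (k - l.+1) * #|V|.
Proof.
move=> lt_lk sE /andP[_ cE] noB ltV.
have e_sym := @adj_sym _ E; have e_irr := adj_irr sE.
have e_conn x y : connect (adj E) x y by move/forallP/(_ x)/forallP: cE.
have vN v : v \notin nbrs (adj E) v by rewrite inE e_irr.
rewrite leqNgt -handshake //; apply: contra noB => dense.
have degV : (exists v, k.-1 <= #|nbrs (adj E) v|) \/ forall v, #|nbrs (adj E) v| < k.
  have [/existsP[v]|] := boolP [exists v, k.-1 <= #|nbrs (adj E) v|].
    by left; exists v.
  rewrite negb_exists => /forallP deg; right=> v.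
  by have := deg v; rewrite -ltnNge; lia.
case: degV => [[v deg_v]|degk].
  have [|p [pp up szp]] := @dense_long_path _ _ e_sym e_irr e_conn l v.
    by rewrite (leq_ltn_trans _ dense) // leq_mul2r leq_maxl orbT.
  apply: (@broom_copy l k _ E v p) => //.
  have := cardsID [set x in p] (nbrs (adj E) v).
  have : #|nbrs (adj E) v :&: [set x in p]| <= l.
    rewrite -szp; have /card_uniqP <- : uniq p by case/andP: up.
    by apply/subset_leq_card/subsetP => x; rewrite !inE => /andP[].
  by lia.
have [v deg_v] : exists v, k - l.+1 < #|nbrs (adj E) v|.
  apply/existsP; apply: contraLR dense; rewrite negb_exists -leqNgt => /forallP deg.
  rewrite mulnC -sum_nat_const leq_sum // => v _.
  by have := deg v; rewrite -leqNgt => /leq_trans; apply; apply: leq_maxr.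
have [p [pp up szp far]] := @far_path _ _ e_conn k l v degk ltV.
apply: (@broom_copy l k _ E v p) => //.
have := cardsID [set x in p] (nbrs (adj E) v).
have : #|nbrs (adj E) v :&: [set x in p]| <= 1.
  case: p far {pp up szp} => [|y p] /= far.
    by rewrite (_ : _ :&: _ = set0) ?cards0 //; apply/setP => x; rewrite !inE andbF.
  rewrite -(cards1 y); apply/subset_leq_card/subsetP => x; rewrite !inE.
  by move=> /andP[vx /orP[//|/far]]; rewrite vx.
by lia.
Qed.

(** * Tails and inner paths of a connected graph *)

Lemma connect_invariant (V : finType) (e : rel V) (P : pred V) x y :
  connect e x y -> (forall a b, P a -> e a b -> P b) -> P x -> P y.
Proof.
case/connectP=> p; elim: p x => [|z p IHp] x /=; first by move=> _ ->.
by move=> /andP[xz pz] Ey stepP Px; apply: (IHp z) => //; apply: stepP xz.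
Qed.

Section ConnectedSets.
Variables (V : finType) (e : rel V).
Hypothesis e_sym : symmetric e.

Definition restr (X : {set V}) : rel V :=
  [rel x y | [&& x \in X, y \in X & e x y]].

Definition conn_set (X : {set V}) :=
  [forall x in X, forall y in X, connect (restr X) x y].

Lemma restr_connect_sym X : connect_sym (restr X).
Proof.
apply: sym_connect_sym => x y; rewrite /restr /= e_sym andbCA.
by [].
Qed.

Lemma conn_setP (X : {set V}) :
  reflect {in X &, forall x y, connect (restr X) x y} (conn_set X).
Proof.
apply: (iffP forall_inP) => [cX x y xX yX|cX x xX].
  by have /forall_inP := cX x xX; apply.
by apply/forall_inP => y; apply: cX.
Qed.

Hypothesis e_conn : forall x y, connect e x y.

Lemma crossing_edge (X : {set V}) x y : x \in X -> y \notin X ->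
  exists a b, [/\ a \in X, b \notin X & e a b].
Proof.
move=> xX /negP yX; apply: boolp.contrapT => nocross; apply: yX.
apply: (connect_invariant (e_conn x y)) => // a b aX eab.
by apply: boolp.contrapT => /negP bX; apply: nocross; exists a, b.
Qed.

(** If all edges leaving [X] share their end in [X], a path between two vertices
    of [X] that leaves [X] must return through the same vertex. *)
Lemma conn_set_bridge (X : {set V}) :
  (forall a b a' b', a \in X -> b \notin X -> e a b ->
     a' \in X -> b' \notin X -> e a' b' -> a = a') ->
  conn_set X.
Proof.
move=> uniq_cross; apply/conn_setP => x y xX yX.
have gate z w : z \in X -> w \in X -> ~~ connect (restr X) z w ->
    exists a b, [/\ a \in X, b \notin X, e a b & connect (restr X) z a].
  move=> zX wX /negP nzw; apply: boolp.contrapT => nocross; apply: nzw.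
  pose R u := (u \in X) && connect (restr X) z u.
  suff /andP[//] : R w.
  apply: (connect_invariant (e_conn z w)); last by rewrite /R zX connect0.
  move=> a b /andP[aX za] eab; apply/andP.
  have bX : b \in X.
    by apply: boolp.contrapT => /negP bX; apply: nocross; exists a, b.
  by split=> //; apply: connect_trans za (connect1 _); rewrite /restr /= aX bX.
apply: boolp.contrapT => /negP nxy.
have [a [b [aX bX ab xa]]] := gate x y xX yX nxy.
have nyx : ~~ connect (restr X) y x by rewrite restr_connect_sym.
have [a' [b' [a'X b'X ab' ya]]] := gate y x yX xX nyx.
case/negP: nxy; apply: connect_trans xa _.
by rewrite restr_connect_sym (uniq_cross a b a' b').
Qed.

(** A connected graph on [X] has at least [#|X| - 1] edges, and each of them
    contains exactly one vertex of colour [c], which lies on at most two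
    edges.  The edges are counted as pairs [Q Y] starting in the colour class,
    for a set [Y] that grows inside [X] one vertex at a time. *)
Lemma conn_set_card (c : pred V) (X : {set V}) :
  (forall x y, e x y -> c x != c y) -> conn_set X ->
  {in X, forall x, #|nbrs e x| <= 2} ->
  #|X| <= 2 * #|[set x in X | c x]| + 1.
Proof.
move=> proper_c /conn_setP cX deg2.
have [->|/set0Pn[r rX]] := eqVneq X set0; first by rewrite cards0.
pose Q (Y : {set V}) :=
  [set p : V * V | [&& p.1 \in Y, c p.1, p.2 \in Y & e p.1 p.2]].
pose P (Y : {set V}) := [/\ r \in Y, Y \subset X & #|Y| <= #|Q Y| + 1].
have [Y [rY YX leY] maxY] : exists2 Y, P Y & forall Y', P Y' -> #|Y'| <= #|Y|.
  apply: (@ex_max_measure _ P _ #|V|) => [|Y _]; last exact: max_card.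
  by exists [set r]; split; rewrite ?set11 ?sub1set ?cards1 ?addn1.
have EYX : Y = X.
  apply/eqP; rewrite eqEsubset YX; apply/subsetP => x xX.
  apply: (connect_invariant (cX r x rX xX)) => // a b Ya /and3P[_ bX eab].
  have aY : a \in Y by [].
  apply: boolp.contrapT => Yb; have bY : b \notin Y by apply/negP.
  have: P (b |: Y).
    split; first by rewrite !inE rY orbT.
      by rewrite subUset sub1set bX.
    rewrite cardsU1 bY add1n addn1 ltnS; apply: leq_trans leY _.
    rewrite addn1; apply: proper_card; apply/properP; split.
      apply/subsetP => [[p1 p2]]; rewrite !inE /= => /and4P[-> -> -> ->].
      by rewrite !orbT.
    have [ca|nca] := boolP (c a).
      exists (a, b); first by rewrite !inE /= aY ca eqxx eab orbT.
      by rewrite inE /= (negPf bY) !andbF.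
    have cb : c b by have := proper_c _ _ eab; rewrite (negPf nca); case: (c b).
    exists (b, a); first by rewrite !inE /= aY cb eqxx [e b a]e_sym eab orbT.
    by rewrite inE /= (negPf bY).
  by move=> /maxY; rewrite cardsU1 bY add1n ltnn.
rewrite EYX in leY; apply: leq_trans leY _; rewrite leq_add2r.
rewrite -sum1_card big_mkcond /=.
rewrite (eq_bigr (fun p => if (p.1, p.2) \in Q X then 1 else 0)); last by case.
rewrite -(pair_bigA _ (fun x y => if (x, y) \in Q X then 1 else 0)) /=.
rewrite mulnC -sum_nat_const [X in _ <= X]big_mkcond /=; apply: leq_sum => x _.
rewrite inE; have [/andP[xX cx]|nx] := boolP ((x \in X) && c x).
  rewrite -big_mkcond /= sum1_card (leq_trans _ (deg2 x xX)) //.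
  apply/subset_leq_card/subsetP => y Qxy; have: (x, y) \in Q X by [].
  by rewrite !inE /= => /and4P[].
rewrite big1 // => y _; case: ifP => //; rewrite inE /= => /and4P[xX cx _ _].
by rewrite xX cx in nx.
Qed.

Definition deg2 : {set V} := [set x | #|nbrs e x| <= 2].

(** In a tree these are, up to degenerate cases, the vertex sets of the pendant
    paths.  Connectedness of the complement makes them disjoint from [core], see
    [thin_core_disjoint]. *)
Definition thin (X : {set V}) := [&& X \subset deg2, conn_set X & conn_set (~: X)].

(** In a tree these are the inner vertices of degree 2, as opposed to those on
    tails: they separate two vertices of degree at least 3. *)
Definition core : {set V} := [set z in deg2 |
  [exists t, exists u, [&& t \notin deg2, u \notin deg2 &
    ~~ connect (restr [set~ z]) t u]]].

Definition thin_pairs : {set {set V} * {set V}} :=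
  [set XY | [&& thin XY.1, thin XY.2 & [disjoint XY.1 & XY.2]]].

Definition tails := \max_(XY in thin_pairs) (#|XY.1| + #|XY.2|).

Definition core_segments : {set {set V}} :=
  [set Z | conn_set Z & Z \subset core].

Definition core_length := \max_(Z in core_segments) #|Z|.

(** The two vertices separated by a core vertex [z] are not in [X], and the
    connected complement of [X] would join them without [z] if [z] were
    in [X]. *)
Lemma thin_core_disjoint X : thin X -> [disjoint X & core].
Proof.
case/and3P=> /subsetP X2 _ /conn_setP cX.
apply/pred0P => z /=; apply/negP => /andP[zX].
rewrite inE => /andP[_ /existsP[t /existsP[u /and3P[t2 u2 /negP]]]]; apply.
have out w : w \notin deg2 -> w \in ~: X.
  by move=> w2; rewrite inE; apply: contra w2; apply: X2.
apply: connect_sub (cX t u (out t t2) (out u u2)) => a b /and3P[].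
rewrite !inE => aX bX eab; apply: connect1; rewrite /restr /= eab !inE andbT.
by apply/andP; split; [apply: contraNneq aX => -> | apply: contraNneq bX => ->].
Qed.

Lemma thin0 : thin set0.
Proof.
apply/and3P; split; first exact: sub0set.
  by apply/conn_setP => x y; rewrite inE.
by apply: conn_set_bridge => a b a' b' _; rewrite !inE.
Qed.

(** Three disjoint connected sets of vertices of degree at most 2, each of which
    has about half of its vertices in the class [c]. *)
Lemma tails_core_length (c : pred V) : (forall x y, e x y -> c x != c y) ->
  tails + core_length <= 2 * #|[set x | c x]| + 3.
Proof.
move=> proper_c.
have arith x y z x' y' z' u w n :
    x <= 2 * x' + 1 -> y <= 2 * y' + 1 -> z <= 2 * z' + 1 ->
    x' + y' = u -> u + z' = w -> w <= n -> x + y + z <= 2 * n + 3 by lia.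
have [|[X Y] XY maxXY] :=
    @eq_bigmax_cond _ (mem thin_pairs) (fun XY => #|XY.1| + #|XY.2|).
  by apply/card_gt0P; exists (set0, set0); rewrite inE /= thin0 -setI_eq0 setI0 /=.
have [|Z Zseg maxZ] := @eq_bigmax_cond _ (mem core_segments) (fun Z => #|Z|).
  apply/card_gt0P; exists set0; rewrite inE sub0set andbT.
  by apply/conn_setP => x y; rewrite inE.
have -> : tails = #|X| + #|Y| := maxXY; have -> : core_length = #|Z| := maxZ.
move: XY Zseg; rewrite !inE /= => /and3P[tX tY dXY] /andP[cZ Zcore].
have [X2 cX _] := and3P tX; have [Y2 cY _] := and3P tY.
have Z2 : Z \subset deg2.
  by apply: subset_trans Zcore _; apply/subsetP => z; rewrite inE => /andP[].
have card2 (S : {set V}) : S \subset deg2 -> conn_set S ->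
    #|S| <= 2 * #|S :&: [set x | c x]| + 1.
  move=> /subsetP S2 cS; have -> : S :&: [set x | c x] = [set x in S | c x].
    by apply/setP => x; rewrite !inE.
  by apply: conn_set_card => // x /S2; rewrite inE.
have disj_core S : thin S -> [disjoint S & Z].
  by move=> /thin_core_disjoint; apply: disjointWr.
have disjI (S S' : {set V}) : [disjoint S & S'] ->
    #|S :&: [set x | c x]| + #|S' :&: [set x | c x]| = #|(S :|: S') :&: [set x | c x]|.
  move=> dS; rewrite setIUl cardsU (_ : _ :&: _ :&: _ = set0) ?cards0 ?subn0 //.
  by apply/eqP; rewrite -setIIl setIAC setI_eq0 (disjointWl (subsetIl _ _)) //.
have dXYZ : [disjoint X :|: Y & Z].
  by rewrite -setI_eq0 setIUl setU_eq0 !setI_eq0 !disj_core.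
apply: (arith _ _ _ _ _ _ _ _ _ (card2 _ X2 cX) (card2 _ Y2 cY) (card2 _ Z2 cZ)
  (disjI _ _ dXY) (disjI _ _ dXYZ)).
exact/subset_leq_card/subsetIr.
Qed.
End ConnectedSets.

(** * Chains of cliques *)

Section Chain.
Variables (m q : nat).

(** Vertices are positions on a line that is cut into blocks of length [q].  The
    first [m] positions of each block form a clique, the others a path to the
    next block. *)
Definition chain : rel nat := fun x y => (x != y) &&
  [|| y == x.+1, x == y.+1 | [&& x %/ q == y %/ q, x %% q < m & y %% q < m]].

(** At these places [v] the only edge between the positions below [v] and the
    others is the one from [v - 1] to [v]. *)
Definition is_cut v := (v %% q == 0) || (m <= v %% q).

Lemma chain_sym : symmetric chain.
Proof.
move=> x y; rewrite /chain eq_sym orbCA [y %/ q == _]eq_sym.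
by rewrite [(y %% q < m) && _]andbC.
Qed.

Lemma chain_irr : irreflexive chain.
Proof. by move=> x; rewrite /chain eqxx. Qed.

Lemma chain_cut v x y : is_cut v -> x < v -> v <= y -> chain x y -> x.+1 = v /\ y = v.
Proof.
move=> cut xv vy /andP[_ /or3P[/eqP yx|/eqP xy|/and3P[/eqP Exy xm ym]]]; [lia|lia|].
have Exv : v %/ q = x %/ q.
  by apply/eqP; rewrite eqn_leq {1}Exy !leq_div2r // ltnW.
have ex := divn_eq x q; have ev := divn_eq v q; have ey := divn_eq y q.
rewrite -Exy in ey; rewrite Exv in ev.
by move: cut; rewrite /is_cut; lia.
Qed.

Lemma chain_link x y : 0 < m -> m <= x %% q -> chain x y -> y = x.-1 \/ y = x.+1.
Proof.
move=> m_gt0 mx /andP[_ /or3P[/eqP yx|/eqP xy|/and3P[_ xm _]]]; [by right|left; lia|lia].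
Qed.

Variables (U : finType) (e : rel U) (F : U -> nat).
Hypotheses (e_sym : symmetric e) (e_conn : forall x y, connect e x y).
Hypotheses (F_inj : injective F) (F_chain : forall x y, e x y -> chain (F x) (F y)).
Hypotheses (m_gt0 : 0 < m) (lt_mq : m < q).

Let left v : {set U} := [set u | F u < v].

Let card_segment (a s : nat) : #|[set u | a <= F u < a + s]| <= s.
Proof.
rewrite cardE -(size_map F) -[leqRHS](size_iota a); apply: uniq_leq_size.
  by rewrite map_inj_uniq ?enum_uniq.
by move=> x /mapP[u]; rewrite mem_enum inE => ? ->; rewrite mem_iota.
Qed.

Let link_deg2 u : m <= F u %% q -> u \in deg2 e.
Proof.
move=> mu; rewrite inE cardE -(size_map F) -[2]/(size [:: (F u).-1; (F u).+1]).
apply: uniq_leq_size; first by rewrite map_inj_uniq ?enum_uniq.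
move=> x /mapP[w]; rewrite mem_enum inE => /F_chain/(chain_link m_gt0 mu) euw ->.
by rewrite !inE; case: euw => ->; rewrite eqxx ?orbT.
Qed.

Let cut_edge v a b : is_cut v -> a \in left v -> b \notin left v -> e a b ->
  (F a).+1 = v /\ F b = v.
Proof.
by rewrite !inE -leqNgt => cv av vb /F_chain; apply: chain_cut.
Qed.

Let conn_left v : is_cut v -> conn_set e (left v).
Proof.
move=> cv; apply: conn_set_bridge => // a b a' b' aX bX ab aX' bX' ab'.
apply: F_inj; apply: succn_inj.
by have [-> _] := cut_edge cv aX bX ab; have [-> _] := cut_edge cv aX' bX' ab'.
Qed.

Let conn_right v : is_cut v -> conn_set e (~: left v).
Proof.
move=> cv; apply: conn_set_bridge => // a b a' b'.
rewrite ![_ \in ~: _]inE !negbK => aX bX ab aX' bX' ab'; apply: F_inj.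
rewrite e_sym in ab; rewrite e_sym in ab'.
by have [_ ->] := cut_edge cv bX aX ab; have [_ ->] := cut_edge cv bX' aX' ab'.
Qed.

Let thin_left v : is_cut v -> left v \subset deg2 e -> thin e (left v).
Proof. by move=> cv lv; apply/and3P; split; rewrite ?conn_left ?conn_right. Qed.

Let thin_right v : is_cut v -> ~: left v \subset deg2 e -> thin e (~: left v).
Proof.
by move=> cv lv; apply/and3P; split; rewrite ?setCK ?conn_left ?conn_right.
Qed.

(** If vertices of degree at least 3 lie on both sides of a connecting path, the
    copy must run through the whole path, whose vertices have degree 2 and
    separate the two. *)
Let link_core i t1 t2 : t1 \notin deg2 e -> t2 \notin deg2 e ->
  F t1 < i * q + m -> i.+1 * q <= F t2 -> q - m <= core_length e.
Proof.
move=> t1D t2D lt1 le2.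
pose Z : {set U} := [set u | i * q + m <= F u < i.+1 * q].
have offset w : i * q + m <= w < i.+1 * q -> m <= w %% q.
  move=> /andP[lw wl]; rewrite -(subnKC (leq_trans (leq_addr m _) lw)) modnMDl.
  by rewrite modn_small; lia.
have cut_link w : i * q + m <= w < i.+1 * q -> is_cut w.
  by move=> /offset mw; rewrite /is_cut mw orbT.
have hit w : i * q + m <= w < i.+1 * q ->
    exists a b, [/\ e a b, (F a).+1 = w & F b = w].
  move=> hw; have [||a [b [aX bX ab]]] := @crossing_edge _ _ e_conn (left w) t1 t2.
  - by rewrite inE; lia.
  - by rewrite inE -leqNgt; lia.
  by have [Ea Eb] := cut_edge (cut_link w hw) aX bX ab; exists a, b.
apply: (@leq_trans #|Z|).
  rewrite cardE -(size_map F) -[leqLHS](size_iota (i * q + m)).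
  apply: uniq_leq_size; first exact: iota_uniq.
  move=> w; rewrite mem_iota => hw; have hw' : i * q + m <= w < i.+1 * q by lia.
  have [_ [b [_ _ Eb]]] := hit w hw'; apply/mapP; exists b => //.
  by rewrite mem_enum inE Eb.
apply: (@leq_bigmax_cond _ (mem (core_segments e)) (fun Z => #|Z|)).
rewrite /= inE; apply/andP; split; last first.
  apply/subsetP => z; rewrite inE => hz; rewrite inE link_deg2 ?offset //=.
  apply/existsP; exists t1; apply/existsP; exists t2; rewrite t1D t2D /=.
  apply/negP => c12; suff: t2 \in left (F z) by rewrite inE; lia.
  apply: (@connect_invariant _ _ [in left (F z)] _ _ c12); last by rewrite inE; lia.
  move=> a b aX /and3P[_ bz ab]; apply: contraLR bz => bX; rewrite !inE negbK.
  have [_ Eb] := cut_edge (cut_link _ hz) aX bX ab.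
  by apply/eqP; apply: F_inj.
have h0 : i * q + m <= i * q + m < i.+1 * q by lia.
have [_ [z0 [_ _ Ez0]]] := hit _ h0.
have from_z0 x : x \in Z -> connect (restr e Z) z0 x.
  have [n] := ubnP (F x); elim: n => // n IHn in x * => ltn xZ.
  have hx : i * q + m <= F x < i.+1 * q by rewrite inE in xZ.
  have [Ex|nEx] := eqVneq (F x) (i * q + m).
    by rewrite (F_inj (etrans Ez0 (esym Ex))) connect0.
  have [a [b [ab Ea Eb]]] := hit _ hx; move/F_inj in Eb; rewrite {b}Eb in ab.
  have aZ : a \in Z by rewrite inE; lia.
  apply: connect_trans (IHn a _ aZ) (connect1 _); first by lia.
  by rewrite /restr /= aZ xZ.
apply/conn_setP => x y xZ yZ; apply: connect_trans (from_z0 y yZ).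
by rewrite restr_connect_sym // from_z0.
Qed.

(** Unless the whole copy is a tail, let [i] be the last block with only a tail
    to its left.  A vertex of degree
    at least 3 then lies in clique [i], as the positions on the connecting path
    have degree at most 2; by [link_core] no such vertex lies beyond that path.
    So only a tail lies to the right of clique [i], and outside the two tails
    there are at most the [m] vertices of this clique. *)
Lemma chain_free (N : nat) : (forall u, F u < N * q) ->
  core_length e < q - m -> #|U| <= tails e + m.
Proof.
move=> ltF short.
have cutM i : is_cut (i * q) by rewrite /is_cut modnMl eqxx.
have cutD i : is_cut (i * q + m) by rewrite /is_cut modnMDl modn_small // leqnn orbT.
have le_tails X Y : thin e X -> thin e Y -> [disjoint X & Y] -> #|X| + #|Y| <= tails e.
  move=> tX tY dXY.
  apply: (@leq_bigmax_cond _ (mem (thin_pairs e)) (fun XY => #|XY.1| + #|XY.2|) (X, Y)).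
  by rewrite /= inE tX tY.
have left0 : left (0 * q) \subset deg2 e by apply/subsetP => u; rewrite inE mul0n.
have [leftN|leftN] := boolP (left (N * q) \subset deg2 e).
  rewrite (leq_trans _ (leq_addr _ _)) //.
  have leftT : left (N * q) = setT by apply/setP => u; rewrite !inE ltF.
  have := le_tails _ _ (thin_left (cutM N) leftN) (thin0 e_sym e_conn).
  by rewrite leftT cards0 addn0 cardsT => -> //; rewrite -setI_eq0 setI0.
have [i lefti leftSi] : exists2 i, left (i * q) \subset deg2 e &
    ~~ (left (i.+1 * q) \subset deg2 e).
  elim: (N) leftN => [|n IHn] leftn; first by rewrite left0 in leftn.
  by have [?|/IHn//] := boolP (left (n * q) \subset deg2 e); exists n.
have righti : ~: left (i * q + m) \subset deg2 e.
  apply/subsetP => t2; rewrite !inE -leqNgt => le2.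
  apply: contraT => t2D; have [t1] := subsetPn leftSi.
  rewrite inE => lt1 t1D; move: short; rewrite ltnNge.
  have in_link t : t \notin deg2 e -> ~~ (i * q + m <= F t < i.+1 * q).
    apply: contra => /andP[lt tl]; apply: link_deg2.
    rewrite -(subnKC (leq_trans (leq_addr m _) lt)) modnMDl modn_small; lia.
  have := in_link t1 t1D; have t2D' : t2 \notin deg2 e by rewrite inE.
  have := in_link t2 t2D' => h2 h1.
  by rewrite (@link_core i t1 t2) //; lia.
have := le_tails _ _ (thin_left (cutM i) lefti) (thin_right (cutD i) righti).
rewrite -setI_eq0 => /(_ _)/(leq_add (card_segment (i * q) m)).
rewrite [m + _]addnC => le_k.
rewrite (leq_trans _ (le_k _)) //; last first.
  by apply/eqP/setP => u; rewrite !inE; lia.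
have cover : [set: U] = left (i * q) :|: [set u | i * q <= F u < i * q + m]
    :|: ~: left (i * q + m).
  by apply/setP => u; rewrite !inE; lia.
rewrite -cardsT cover (leq_trans (leq_card_setU _ _)) // [leqRHS]addnC.
by rewrite addnAC leq_add2r addnC addnC leq_card_setU.
Qed.
End Chain.

(** * Dense connected graphs without a given connected subgraph *)

Lemma connected_graph_from (V : finType) (E : {set {set V}}) (o : V) :
  (forall x, connect (adj E) x o) -> connected_graph E.
Proof.
move=> conn_o; apply/andP; split; first by apply/card_gt0P; exists o.
apply/forallP => x; apply/forallP => y; apply: connect_trans (conn_o x) _.
by rewrite (sym_connect_sym (@adj_sym _ _)).
Qed.

Section ChainGraph.
Variables (m q N : nat).
Hypotheses (m_gt0 : 0 < m) (lt_mq : m < q) (N_gt0 : 0 < N).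

Definition chain_ord : rel 'I_(N * q) := fun x y => chain m q x y.
Definition chain_graph := graph_of chain_ord.

Lemma chain_ord_sym : symmetric chain_ord.
Proof. by move=> x y; apply: chain_sym. Qed.

Lemma chain_ord_irr : irreflexive chain_ord.
Proof. by move=> x; apply: chain_irr. Qed.

Lemma chain_graph_connected : connected_graph chain_graph.
Proof.
have n_gt0 : 0 < N * q by rewrite muln_gt0 N_gt0 (leq_ltn_trans _ lt_mq).
apply: (@connected_graph_from _ _ (Ordinal n_gt0)) => x.
have [n] := ubnP (x : nat); elim: n => // n IHn in x * => ltxn.
have [x0|x_gt0] := posnP x; first by rewrite (_ : x = Ordinal n_gt0) //; apply: val_inj.
have lt_px : x.-1 < N * q by rewrite (leq_ltn_trans (leq_pred _)).
apply: (@connect_trans _ _ (Ordinal lt_px)); last by apply: IHn => /=; lia.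
apply: connect1; rewrite (adj_graph_of chain_ord_sym chain_ord_irr).
by rewrite /chain_ord /chain /= prednK // eqxx orbT andbT; lia.
Qed.

Lemma sum_blocks (f : nat -> nat) :
  \sum_(0 <= x < N * q) f (x %% q) = N * \sum_(0 <= x < q) f x.
Proof.
elim: (N) => [|n IHn]; first by rewrite !mul0n big_nil.
rewrite mulSnr (big_cat_nat (n := n * q)) ?leq_addr //= IHn [RHS]mulSnr; congr (_ + _).
rewrite -{1}[n * q]add0n big_addn addKn; apply: eq_big_nat => x /andP[_ ltxq].
by rewrite addnC modnMDl modn_small.
Qed.

Lemma chain_graph_edges : N * (m * m.-1) <= 2 * #|chain_graph|.
Proof.
rewrite -handshake; last exact: graph_of_simple chain_ord_irr.
have <- : \sum_(0 <= x < q) (if x < m then m.-1 else 0) = m * m.-1.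
  rewrite (big_cat_nat (n := m)) ?(ltnW lt_mq) //= [X in _ + X]big_nat_cond.
  rewrite [X in _ + X]big1 ?addn0 => [|x /andP[/andP[mx _] _]]; last by rewrite ltnNge mx.
  rewrite (eq_big_nat _ _ (F2 := fun=> m.-1)) => [|x /andP[_ ->]] //.
  by rewrite sum_nat_const_nat subn0.
rewrite -sum_blocks big_mkord; apply: leq_sum => x _.
case: ltnP => // xm; rewrite -ltnS prednK // -add1n.
pose a := x %/ q * q.
have q_gt0 : 0 < q by apply: leq_trans lt_mq.
have ltxN : x %/ q < N by rewrite ltn_divLR.
have le_an : a + q <= N * q by rewrite /a addnC -mulSn leq_mul2r ltxN orbT.
apply: (@leq_trans #|x |: nbrs (adj chain_graph) x|); last first.
  by rewrite cardsU1 leq_add2r; case: (x \notin _).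
rewrite cardE -(size_map val) -[leqLHS](size_iota a); apply: uniq_leq_size.
  exact: iota_uniq.
move=> y; rewrite mem_iota => /andP[ay ya].
have lty : y < N * q by lia.
apply/mapP; exists (Ordinal lty) => //; rewrite mem_enum !inE -val_eqE /=.
rewrite (adj_graph_of chain_ord_sym chain_ord_irr) /chain_ord /chain /= eq_sym.
have ltyq : y - a < q by lia.
case: eqVneq => //= _; apply/or3P; apply: Or33.
rewrite -(subnKC ay) divnMDl // modnMDl (divn_small ltyq) (modn_small ltyq).
by rewrite addn0 eqxx xm /=; lia.
Qed.
End ChainGraph.

Section BipartiteGraph.
Variables (a n : nat).
Definition bip_rel : rel 'I_n := fun x y => (x < a) != (y < a).
Definition bip_graph := graph_of bip_rel.

Lemma bip_rel_sym : symmetric bip_rel.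
Proof. by move=> x y; rewrite /bip_rel eq_sym. Qed.

Lemma bip_rel_irr : irreflexive bip_rel.
Proof. by move=> x; rewrite /bip_rel eqxx. Qed.

Lemma bip_graph_connected : 0 < a < n -> connected_graph bip_graph.
Proof.
move=> /andP[a_gt0 lt_an]; have n_gt0 : 0 < n by lia.
pose o := Ordinal n_gt0; pose z := Ordinal lt_an.
have adjE := adj_graph_of bip_rel_sym bip_rel_irr.
have zo : connect (adj bip_graph) z o.
  by apply: connect1; rewrite adjE /bip_rel /= ltnn a_gt0.
apply: (@connected_graph_from _ _ o) => x; have [xa|ax] := ltnP x a.
  apply: connect_trans zo; apply: connect1.
  by rewrite adjE /bip_rel /= ltnn xa.
by apply: connect1; rewrite adjE /bip_rel /= a_gt0 ltnNge ax.
Qed.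

Lemma bip_graph_edges : a <= n -> a * (n - a) <= #|bip_graph|.
Proof.
move=> le_an; rewrite -(@leq_pmul2l 2) //.
rewrite -handshake; last exact: graph_of_simple bip_rel_irr.
have adjE := adj_graph_of bip_rel_sym bip_rel_irr.
pose A := [set x : 'I_n | x < a].
have cardA : #|A| = a.
  have -> : A = [set widen_ord le_an i | i in 'I_a].
    apply/setP => x; rewrite inE.
    apply/idP/imsetP => [xa|[i _ ->]]; last exact: (ltn_ord i).
    by exists (Ordinal xa) => //; apply: val_inj.
  rewrite card_imset ?card_ord //.
  by move=> i j /(congr1 val) /= eij; apply: val_inj.
have cardCA : #|~: A| = n - a by rewrite cardsCs setCK card_ord cardA.
have Nin x : x \in A -> nbrs (adj bip_graph) x = ~: A.
  by rewrite inE => xA; apply/setP => y; rewrite !inE adjE /bip_rel xA; case: (y < a).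
have Nout x : x \notin A -> nbrs (adj bip_graph) x = A.
  by rewrite inE => /negPf xA; apply/setP => y; rewrite !inE adjE /bip_rel xA; case: (y < a).
rewrite (bigID (mem A)) /=.
rewrite (eq_bigr (fun=> n - a)) => [|x /Nin ->//].
rewrite sum_nat_const cardA (eq_bigr (fun=> a)) => [|x /Nout ->//].
have -> : \sum_(i | i \notin A) a = (n - a) * a.
  by rewrite -cardCA -sum_nat_const; apply: eq_bigl => x; rewrite in_setC.
by rewrite mul2n -addnn [(n - a) * a]mulnC.
Qed.
End BipartiteGraph.

Lemma contains_copyP (U V : finType) (F : {set {set U}}) (E : {set {set V}}) :
  contains_copy F E ->
  exists2 f : U -> V, injective f & forall x y, adj F x y -> adj E (f x) (f y).
Proof.
move=> /existsP[f /andP[/injectiveP f_inj /forallP fE]]; exists f => // x y.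
by move/forallP/(_ y)/implyP: (fE x); apply.
Qed.

(** A copy of [T] in the complete bipartite graph [bip_graph a n] pulls back to a
    proper 2-colouring of [T] whose first class has at most [a] vertices.  If
    such a colouring exists, it bounds the parameters of the chain. *)
Lemma tree_free_dense_graph (k : nat) (T : {set {set 'I_k}}) (M : nat) :
  20 <= k -> connected_graph T ->
  exists n (E : {set {set 'I_n}}), [/\ M < n, simple_graph E, connected_graph E,
    ~~ contains_copy T E & n * k <= 4 * #|E| + 20 * n].
Proof.
move=> k_ge20 /andP[_ cT]; pose a := k %/ 4.
have T_conn x y : connect (adj T) x y by move/forallP/(_ x)/forallP: cT.
have a_le : 4 * a <= k by rewrite /a; lia.
have [[c [proper_c le_c]]|noc] := boolp.EM (exists c : pred 'I_k,
  (forall x y, adj T x y -> c x != c y) /\ #|[set x | c x]| <= a); last first.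
  pose n := M.+1 + a * k.
  have an : 0 < a < n by rewrite /n /a; nia.
  exists n, (bip_graph a n); split.
  - by rewrite /n leq_addr.
  - exact/graph_of_simple/bip_rel_irr.
  - exact: bip_graph_connected.
  - apply/negP => /contains_copyP[f f_inj fE]; apply: noc.
    exists (fun x => f x < a); split.
      by move=> x y /fE; rewrite (adj_graph_of (@bip_rel_sym a n) (@bip_rel_irr a n)).
    rewrite cardE -(size_map (val \o f)) -[leqRHS](size_iota 0).
    apply: uniq_leq_size.
      by rewrite map_inj_uniq ?enum_uniq //; apply: inj_comp f_inj; apply: val_inj.
    by move=> x /mapP[u]; rewrite mem_enum inE => ? ->; rewrite mem_iota.
  - have lt_k : k <= 4 * a + 3 by rewrite /a; lia.
    have le_akn : a * k <= n by rewrite /n leq_addl.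
    have le_an : a <= n by lia.
    have := bip_graph_edges le_an; rewrite mulnBr.
    have : a * (4 * a) <= a * k by rewrite leq_mul2l a_le orbT.
    have : n * k <= n * (4 * a + 3) by rewrite leq_mul2l lt_k orbT.
    rewrite mulnDr mulnCA [a * (4 * a)]mulnCA [n * a]mulnC.
    move: #|bip_graph a n| (n * k) (a * n) (a * a) (a * k) le_akn; clear.
    by lia.
have := tails_core_length (@adj_sym _ T) T_conn proper_c.
set P := tails _; set l := core_length _ => le_Pl'.
have le_Pl : P + l <= 2 * a + 3.
  by apply: leq_trans le_Pl' _; rewrite leq_add2r leq_mul2l.
pose m := k.-1 - P; pose q := m + l.+1.
have m_gt1 : 1 < m by rewrite /m; lia.
have lt_mq : m < q by rewrite /q; lia.
exists (M.+1 * q), (chain_graph m q M.+1); split.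
- by rewrite /q; nia.
- exact/graph_of_simple/chain_ord_irr.
- by apply: chain_graph_connected => //; lia.
- apply/negP => /contains_copyP[f f_inj fE].
  have := @chain_free m q _ _ (val \o f) (@adj_sym _ T) T_conn _ _ _ lt_mq M.+1.
  rewrite card_ord -/P -/l => H.
  suff: k <= P + m by rewrite /m; lia.
  apply: H.
  + by apply: inj_comp f_inj; apply: val_inj.
  + move=> x y /fE; rewrite adj_graph_of //; [exact: chain_ord_sym | exact: chain_ord_irr].
  + lia.
  + by move=> u /=; apply: ltn_ord.
  + by rewrite /q; lia.
- have m_gt0 : 0 < m by lia.
  have := @chain_graph_edges m q M.+1 m_gt0 lt_mq (ltn0Sn M).
  move: #|_| => E le_E.
  have le_m : 2 * q + (k - 14) <= 4 * m.-1 by rewrite /q /m; lia.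
  (* The arithmetic-geometric mean inequality for [2 * q] and [k - 14]. *)
  have le_block : q * k <= 2 * (m * m.-1) + 20 * q.
    have sq_le : (2 * q + (k - 14)) ^ 2 <= (4 * m.-1) ^ 2 by rewrite leq_sqr.
    have := leq_trans (nat_AGM2 (2 * q) (k - 14)) sq_le.
    rewrite expnMn -[m.-1 ^ 2]mulnn -mulnA.
    have : m.-1 * m.-1 <= m * m.-1 by rewrite leq_mul2r leq_pred orbT.
    have : q * k <= q * (k - 14) + 14 * q.
      by rewrite [14 * q]mulnC -mulnDr leq_mul2l; apply/orP; right; lia.
    move: (m * m.-1) (m.-1 * m.-1) (q * (k - 14)) (q * k); clear.
    by lia.
  have : M.+1 * (q * k) <= M.+1 * (2 * (m * m.-1) + 20 * q).
    by rewrite leq_mul2l le_block orbT.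
  by move: le_E; rewrite mulnDr -!mulnA; clear; lia.
Qed.

(** * Passage to the limit *)

From mathcomp Require Import all_order all_algebra.
From mathcomp Require Import all_classical all_reals all_analysis.
From mathcomp Require Import lra.

Import Order.TTheory GRing.Theory Num.Theory.
Import numFieldNormedType.Exports.

Local Open Scope classical_set_scope.
Local Open Scope ring_scope.

Lemma tree_density_ge (R : realType) (k : nat) (T : {set {set 'I_k}}) (c : R) :
  (forall M, exists2 n, (M < n)%N & c <= (ex_c n T)%:R / (n%:R * (k%:R - 2) / 2)) ->
  (c%:E <= tree_density R T)%E.
Proof.
move=> often; apply: le_ereal_inf_tmp => _ [A [M _ MA] <-].
have [n ltMn le_c] := often M; apply: le_ereal_sup_tmp.
by eexists; [exists n; [exact/MA/ltnW | reflexivity] | rewrite lee_fin].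
Qed.

Lemma tree_density_le (R : realType) (k : nat) (T : {set {set 'I_k}}) (c : R) (M : nat) :
  (forall n, (M < n)%N -> (ex_c n T)%:R / (n%:R * (k%:R - 2) / 2) <= c) ->
  (tree_density R T <= c%:E)%E.
Proof.
move=> eventually_le; apply: ge_ereal_inf.
exists (ereal_sup [set ((ex_c n T)%:R / (n%:R * (k%:R - 2) / 2))%:E |
                   n in [set n | (M < n)%N]]).
  exists [set n | (M < n)%N] => //.
  by exists M.+1 => // n.
by apply: ge_ereal_sup => _ [n Mn <-]; rewrite lee_fin eventually_le.
Qed.

(** The densities are within [9 / (k - 2)] of one half; [20 * harmonic k], which
    is [20 / (k + 1)], is a coarser error term with a known limit. *)
Lemma ratio_bounds (R : realType) (k n E : nat) : (20 <= k)%N -> (0 < n)%N ->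
  ((n * k <= 4 * E + 20 * n)%N ->
    1 / 2 - 20 * harmonic k <= E%:R / (n%:R * (k%:R - 2) / 2) :> R) /\
  ((4 * E <= k * n)%N ->
    E%:R / (n%:R * (k%:R - 2) / 2) <= 1 / 2 + 20 * harmonic k :> R).
Proof.
move=> k20 n_gt0.
have kR : 20 <= k%:R :> R by rewrite (ler_nat R 20).
have nR : 0 < n%:R :> R by rewrite ltr0n.
have den : 0 < n%:R * (k%:R - 2) / 2 :> R by rewrite divr_gt0 ?mulr_gt0 //; lra.
have hE : harmonic k * (k%:R + 1) = 1 :> R.
  by rewrite /harmonic /= -natr1 mulVf // gt_eqF //; lra.
have h0 : 0 <= harmonic k :> R by exact: harmonic_ge0.
set h : R := harmonic k in hE h0 *.
have hk : 9 <= 20 * h * (k%:R - 2) by nra.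
split=> le_E.
  rewrite ler_pdivlMr //.
  have : n%:R * k%:R <= 4 * E%:R + 20 * n%:R :> R.
    by rewrite -natrM -[4]/(4%:R) -[20]/(20%:R) -!natrM -natrD ler_nat.
  have : n%:R * 9 <= n%:R * (20 * h * (k%:R - 2)) by rewrite ler_pM2l.
  nra.
rewrite ler_pdivrMr //.
have : 4 * E%:R <= k%:R * n%:R :> R by rewrite -[4]/(4%:R) -!natrM ler_nat.
have : n%:R * 9 <= n%:R * (20 * h * (k%:R - 2)) by rewrite ler_pM2l.
nra.
Qed.

Lemma gamma_ge (R : realType) (k : nat) : (20 <= k)%N ->
  ((1 / 2 - 20 * harmonic k : R)%:E <= gamma R k)%E.
Proof.
move=> k20; apply: le_ereal_inf_tmp => _ [T [sT cT _] <-].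
apply: tree_density_ge => M.
have [n [E [Mn sE cE noT le_E]]] := tree_free_dense_graph M k20 cT.
exists n => //; have n_gt0 : (0 < n)%N by rewrite (leq_ltn_trans _ Mn).
apply: (ratio_bounds R (ex_c n T) k20 n_gt0).1.
apply: leq_trans le_E _; rewrite leq_add2r leq_mul2l /=.
apply: (@bigop.leq_bigmax_cond _ (fun E : {set {set 'I_n}} =>
  [&& simple_graph E, connected_graph E & ~~ contains_copy T E]) (fun E => #|E|)).
by rewrite sE cE noT.
Qed.

Lemma gamma_le (R : realType) (k : nat) : (20 <= k)%N ->
  (gamma R k <= (1 / 2 + 20 * harmonic k : R)%:E)%E.
Proof.
move=> k20; pose l := (k %/ 2)%N.
have ltlk : (l < k)%N by rewrite /l; lia.
apply: ge_ereal_inf; exists (tree_density R (broom l k)).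
  by exists (broom l k) => //; apply: broom_tree; lia.
apply: (@tree_density_le _ _ _ _ (k ^ l)) => n ltn.
have n_gt0 : (0 < n)%N by rewrite (leq_ltn_trans _ ltn).
apply: (ratio_bounds R (ex_c n (broom l k)) k20 n_gt0).2.
have half (E : nat) : (2 * E <= l * n)%N -> (4 * E <= k * n)%N.
  move=> le_E; apply: (@leq_trans (2 * (l * n))); first by lia.
  by rewrite mulnA leq_mul2r; apply/orP; right; rewrite /l; lia.
apply: half; suff : (ex_c n (broom l k) <= (l * n) %/ 2)%N by lia.
apply/bigop.bigmax_leqP => E /and3P[sE cE noB].
have := broom_free_edges ltlk sE cE noB; rewrite card_ord => /(_ ltn).
have -> : maxn l (k - l.+1) = l by apply/maxn_idPl; rewrite /l; lia.
by lia.
Qed.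

Theorem theorem1p1 (R : realType) :
  gamma R k @[k --> \oo] --> ((1 / 2 : R)%:E).
Proof.
have lim (s : R) : (1 / 2 + s * harmonic k : R)%:E @[k --> \oo] --> ((1 / 2 : R)%:E).
  apply: cvg_EFin; first exact: nearW.
  rewrite -[X in _ --> X]addr0 -(mulr0 s).
  by apply: cvgD; [exact: cvg_cst | apply: cvgMl_tmp; exact: cvg_harmonic].
apply: (squeeze_cvge _ (lim (- 20)) (lim 20)).
exists 20%N => // k /= k20; rewrite gamma_le // andbT mulNr.
exact: gamma_ge.
Qed.
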